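(* Let $X$ be a topological space. Then $X$ is $\omega$-sequential if and only if its Alexandroff compactification $X^+$ is a sequential space.
   Context: No separation axioms are assumed. A subset $U$ of a topological space $X$ is sequentially open if every sequence in $X$ that converges to a point of $U$ is eventually in $U$; a subset is sequentially closed if its complement is sequentially open. $X$ is sequential if every sequentially open subset is open. A proper sequence in $X$ is a sequence $s:\mathbb{N}\to X$ such that $s^{-1}(K)$ is finite for every closed compact subset $K\subset X$. A subset $C\subset X$ is s-compact if $C$ is sequentially closed and every proper sequence in $X$ is eventually in $X\setminus C$. $X$ is $\omega$-sequential if it is a sequential space and its s-compact subsets are exactly its closed compact subsets. For any topological space $(X,\tau)$, the Alexandroff compactification is $X^+=X\cup\{\infty\}$ (with $\infty\notin X$), with open sets the members of $\tau$ together with the sets $U\cup\{\infty\}$ where $U\in\tau$ and $X\setminus U$ is compact. *)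

(* Defs.v *)
From mathcomp Require Import all_boot all_order all_algebra.
From mathcomp Require Import all_classical topology.

Set Implicit Arguments.
Unset Strict Implicit.
Unset Printing Implicit Defensive.

Local Open Scope classical_set_scope.

Definition sequentially_open (X : topologicalType) (U : set X) : Prop :=
  forall (s : nat -> X) (x : X),
    U x -> s @ \oo --> x -> \forall n \near \oo, U (s n).

Definition sequentially_closed (X : topologicalType) (C : set X) : Prop :=
  sequentially_open (~` C).

Definition sequential (X : topologicalType) : Prop :=
  forall U : set X, sequentially_open U -> open U.

Definition proper_sequence (X : topologicalType) (s : nat -> X) : Prop :=
  forall K : set X, closed K -> compact K -> finite_set (s @^-1` K).

Definition s_compact (X : topologicalType) (C : set X) : Prop :=
  sequentially_closed C /\
  forall s : nat -> X, proper_sequence s -> \forall n \near \oo, (~` C) (s n).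

Definition omega_sequential (X : topologicalType) : Prop :=
  sequential X /\
  forall C : set X, s_compact C <-> (closed C /\ compact C).

(* The library defines [one_point_compactification X] by its neighborhood
   filters, for arbitrary X; its open sets are those of the Alexandroff
   compactification, with [None] as the point at infinity. *)
Lemma open_one_point_compactificationE (X : topologicalType)
    (W : set (one_point_compactification X)) :
  open W <->
  (exists2 U : set X, open U & W = Some @` U) \/
  (exists U : set X,
     [/\ open U, compact (~` U) & W = (Some @` U) `|` [set None]]).
Proof.
split.
- rewrite openE => oW.
  have oU : open (Some @^-1` W) by rewrite openE => x /oW.
  have [WN|WN] := pselect (W None).
  + right; exists (Some @^-1` W); split=> //.
    * have [K [cK _] KW] := oW _ WN.
      apply: (subclosed_compact _ cK); first exact: open_closedC.
      by move=> x nWx; apply: contrapT => nKx; apply: nWx; apply: KW; left;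
        exists x.
    * apply/seteqP; split=> [[x|] Wx|_ [[x Wx <-]|->]] //; last by right.
      by left; exists x.
  + left; exists (Some @^-1` W) => //.
    by apply/seteqP; split=> [[x|] Wx|_ [x Wx <-]] //; exists x.
- case=> [[U oU ->]|[U [oU cU ->]]].
    exact: one_point_compactification_open_some.
  rewrite openE => -[x|] Wx.
  + have Ux : U x by case: Wx => [[y Uy [<-]]|].
    apply: (@filterS _ (nbhs x) _ U); last exact: open_nbhs_nbhs.
    by move=> y Uy; left; exists y.
  + exists (~` U); first by split=> //; exact: open_closedC.
    by rewrite setCK.
Qed.

(* Main.v *)
Require Import Defs.
From mathcomp Require Import all_boot all_order all_algebra.
From mathcomp Require Import all_classical topology.

(** Both properties compare two families of subsets of X+ = X u {oo}.  A set W
    is open in X+ iff its trace on X is open and, when oo lies in W, the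
    complement of W is compact.  The sequentially open sets have the same shape
    with s-compact in place of closed compact: W is sequentially open iff its
    trace is sequentially open in X and, when oo lies in W, the complement of W
    is s-compact (lemma sequentially_open_opcP).  The bridge is that a sequence
    in X converges to oo in X+ exactly when it is proper.  Hence every
    sequentially open set of X+ is open iff every sequentially open set of X is
    open and every s-compact set of X is closed and compact; the remaining
    inclusion, that closed compact sets are s-compact, holds in every space,
    because open sets of X+ are sequentially open. *)

Set Implicit Arguments.
Unset Strict Implicit.
Unset Printing Implicit Defensive.

Local Open Scope classical_set_scope.

Lemma finite_set_nearP (A : set nat) :
  finite_set A <-> \forall n \near \oo, ~ A n.
Proof.
split=> [/finite_seqP[s ->]|[N _ AN]].
  exists (\max_(i <- s) i).+1 => // n /= ltn sn.
  by have := @leq_bigmax_seq _ s xpredT id n sn isT; rewrite leqNgt ltn.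
apply: (sub_finite_set _ (finite_II N)) => n An /=.
by rewrite ltnNge; apply/negP => /AN.
Qed.

Lemma not_near_subsequence (A : set nat) :
  ~ (\forall n \near \oo, A n) ->
  exists2 g : nat -> nat, g n @[n --> \oo] --> \oo & forall n, ~ A (g n).
Proof.
move=> nA.
have /choice[g gP] : forall n, exists m, (n <= m)%N /\ ~ A m.
  move=> n; apply: contrapT => noM; apply: nA; exists n => // m /= nm.
  by apply: contrapT => Am; apply: noM; exists m.
exists g; last by move=> n; have [] := gP n.
apply/cvgnyPge => N; exists N => // n /= Nn.
by apply: leq_trans Nn _; have [] := gP n.
Qed.

Lemma open_sequentially_open (X : topologicalType) (U : set X) :
  open U -> sequentially_open U.
Proof. by move=> oU s x Ux; apply; exact: open_nbhs_nbhs. Qed.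

Section compactification.
Variable X : topologicalType.
Local Notation opc := (one_point_compactification X).
Implicit Types (s : nat -> X) (W : set opc).

(** The basic neighbourhoods of infinity are the complements of the closed
    compact sets, so converging to infinity means leaving each of them. *)
Lemma proper_sequence_cvgP s :
  proper_sequence s <-> (Some \o s : nat -> opc) @ \oo --> (None : opc).
Proof.
split=> [ps W [K [cK clK] KW]|sN K clK cK].
- have /finite_set_nearP := ps K clK cK.
  by apply: filterS => n nKs; apply: KW; left; exists (s n).
- apply/finite_set_nearP.
  have : nbhs (None : opc) ((Some @` (~` K)) `|` [set None]) by exists K.
  move=> /sN[N _ NK]; exists N => // n /NK[[x nKx [xs]]|] // Ks.
  by apply: nKx; rewrite xs.
Qed.

Lemma open_opcP W :
  open W <-> open (Some @^-1` W) /\ (W None -> compact (Some @^-1` (~` W))).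
Proof.
split=> [/open_one_point_compactificationE[[U oU ->]|[U [oU cU ->]]]|[oU cU]].
- have -> : Some @^-1` (Some @` U) = U.
    by apply/seteqP; split=> [x [y Uy [<-]]|x Ux] //; exists x.
  by split=> // -[].
- have UE : Some @^-1` ((Some @` U) `|` [set None]) = U.
    by apply/seteqP; split=> [x [[y Uy [<-]]|]|x Ux] //; left; exists x.
  by rewrite -preimage_setC UE.
- apply/open_one_point_compactificationE.
  have [WN|WN] := pselect (W None); [right|left]; exists (Some @^-1` W) => //.
  + split=> //; first exact: cU.
    by apply/seteqP; split=> [[x|] Wx|_ [[x Wx <-]|->]] //;
      [left; exists x|right].
  + by apply/seteqP; split=> [[x|] Wx|_ [x Wx <-]] //; exists x.
Qed.

(** The converse is the substantial direction.  A sequence with a limit in X is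
    eventually in X, hence has the same limit as a sequence of points of X.  If
    a sequence converging to infinity were not eventually in W, a subsequence
    would stay in the s-compact set X \ W; being proper it would have to leave
    that set. *)
Lemma sequentially_open_opcP W :
  sequentially_open W <->
  sequentially_open (Some @^-1` W) /\
  (W None -> s_compact (Some @^-1` (~` W))).
Proof.
split=> [oW|[oU cU] t [x|] Wp tp].
- have oU : sequentially_open (Some @^-1` W).
    move=> s x Wx sx; apply: (oW (Some \o s) (Some x)) => //.
    exact: (cvg_comp _ _ sx (one_point_compactification_some_continuous x)).
  split=> // WN; split; first by rewrite /sequentially_closed -preimage_setC setCK.
  move=> s /proper_sequence_cvgP sN; rewrite -preimage_setC setCK.
  exact: (oW (Some \o s) None).
- (* x is the value of s at the indices where t is at infinity. *)
  pose s n := if t n is Some y then y else x.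
  have tE : \forall n \near \oo, t n = Some (s n).
    have [N _ tN] := tp _ (one_point_compactification_some_nbhs x setT filterT).
    by exists N => // n /tN[y _ ty]; rewrite /s -ty.
  have sx : s @ \oo --> x.
    move=> U /one_point_compactification_some_nbhs/tp[N _ tN].
    by exists N => // n /tN[y Uy ty]; rewrite /= /s -ty.
  have Us := oU s x Wp sx.
  by near=> n; rewrite (near tE n) //; near: n.
- apply: contrapT => /not_near_subsequence[g goo gW].
  have /choice[s sP] : forall n, exists x, t (g n) = Some x.
    move=> n; case E: (t (g n)) => [x|]; first by exists x.
    by case: (gW n); rewrite E.
  have ps : proper_sequence s.
    apply/proper_sequence_cvgP.
    have -> : (Some \o s : nat -> opc) = t \o g by apply/funext => n /=.
    exact: (cvg_comp _ _ goo tp).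
  have [_ /(_ s ps)[N _ /(_ N (leqnn N))]] := cU Wp.
  by apply=> /=; rewrite -sP; exact: gW.
Unshelve. all: by end_near. Qed.

End compactification.

Theorem theorem3p10 (X : topologicalType) :
  omega_sequential X <-> sequential (one_point_compactification X).
Proof.
split=> [[seqX scX] W /sequentially_open_opcP[oU cU]|seqXp].
  apply/open_opcP; split; first exact: seqX.
  by move=> /cU/scX[].
split=> [U oU|C].
- (* U as a subset of X+ does not contain infinity. *)
  have UE : Some @^-1` (Some @` U) = U.
    by apply/seteqP; split=> [x [y Uy [<-]]|x Ux] //; exists x.
  have : sequentially_open (Some @` U : set (one_point_compactification X)).
    by apply/sequentially_open_opcP; rewrite UE; split=> // -[].
  by move=> /seqXp/open_opcP[]; rewrite UE.
- pose W : set (one_point_compactification X) := ~` (Some @` C).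
  have WN : W None by case.
  have WE : Some @^-1` W = ~` C.
    apply/seteqP; split=> [x Wx Cx|x nCx [y Cy [yx]]]; first by apply: Wx; exists x.
    by apply: nCx; rewrite -yx.
  have CE : Some @^-1` (~` W) = C by rewrite -preimage_setC WE setCK.
  split=> [sC|[clC cC]].
  + have /seqXp/open_opcP[] : sequentially_open W.
      by apply/sequentially_open_opcP; rewrite WE CE; case: sC.
    by rewrite WE CE => oC /(_ WN) cC; split=> //; rewrite -openC.
  + have /open_sequentially_open/sequentially_open_opcP[_] : open W.
      by apply/open_opcP; rewrite WE CE openC.
    by rewrite CE; apply.
Qed.
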